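(* Let $(M,d)$ be a metric space. Then the following statements hold: (1) If $(M,d)$ is compact, the space $C_b(M)$ is weakly Banach--Saks if and only if $M^{(\omega)} = \emptyset$. (2) If $(M,d)$ is not compact, the space $C_b(M)$ is not weakly Banach--Saks.
   Context: A Banach space $X$ has the weak Banach--Saks property (is weakly Banach--Saks) if every weakly convergent sequence $x_n \to x$ in $X$ contains a subsequence $(x_{n_k})$ such that $\left\| \frac{1}{N}\sum_{k=1}^N x_{n_k} - x \right\|_X \to 0$ as $N \to \infty$. For a metric space $(M,d)$, $C_b(M)$ denotes the Banach space of all bounded continuous functions $f: M\to\mathbb{R}$ with the supremum norm $\|f\|_{C(M)} := \sup_{x\in M}|f(x)|$. $M^{(n)}$ denotes the $n$-th derived set of $M$, that is, $M^{(1)}$ is the set of accumulation points of $M$ and $M^{(n+1)}$ is the set of accumulation points of $M^{(n)}$ for $n \ge 1$; and $M^{(\omega)} := \bigcap_{n=1}^{\infty} M^{(n)}$. *)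

(* Defs.v *)
From HB Require Import structures.
From mathcomp Require Import all_boot all_order all_algebra.
From mathcomp Require Import all_classical all_reals all_analysis.

Set Implicit Arguments.
Unset Strict Implicit.
Unset Printing Implicit Defensive.

Import Order.TTheory GRing.Theory Num.Theory.
Import numFieldNormedType.Exports.

Local Open Scope classical_set_scope.
Local Open Scope ring_scope.

Section bounded_continuous_functions.
Context {R : realType} {M : topologicalType}.

Definition bounded_continuous : {pred M -> R} :=
  [pred f : M -> R | `[< continuous f /\ bounded_fun f >]].

Lemma bounded_continuousP (f : M -> R) :
  reflect (continuous f /\ bounded_fun f) (f \in bounded_continuous).
Proof. by rewrite inE; exact: asboolP. Qed.

Lemma bounded_funE (f : M -> R) :
  bounded_fun f <-> exists B, forall x, `|f x| <= B.
Proof.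
split=> [[B [_ fB]]|[B fB]].
  by exists (B + 1) => x; apply: (fB (B + 1)) => //; rewrite ltrDl.
exists B; split; first exact: num_real.
by move=> C BC x _ /=; rewrite (le_trans (fB x))// ltW.
Qed.

Lemma bounded_continuous_submod_closed : submod_closed bounded_continuous.
Proof.
split=> [|a f g /bounded_continuousP[fc /bounded_funE[B fB]]
           /bounded_continuousP[gc /bounded_funE[C gC]]].
  apply/bounded_continuousP; split; first exact: cst_continuous.
  by apply/bounded_funE; exists 0 => x; rewrite normr0.
apply/bounded_continuousP; split.
  move=> x; apply: cvgD; last exact: gc.
  by apply: cvgZr; exact: fc.
apply/bounded_funE; exists (`|a| * B + C) => x.
rewrite (le_trans (ler_normD _ _))// lerD// normrM.
exact: ler_wpM2l.
Qed.

HB.instance Definition _ := GRing.isSubmodClosed.Build R (M -> R)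
  bounded_continuous bounded_continuous_submod_closed.

End bounded_continuous_functions.

Record Cb (R : realType) (M : topologicalType) := MkCb {
  Cb_fun :> M -> R ;
  _ : Cb_fun \in bounded_continuous
}.

Section Cb_normed.
Context {R : realType} {M : topologicalType}.
Implicit Types f g : Cb R M.

HB.instance Definition _ := [isSub for @Cb_fun R M].
HB.instance Definition _ := [Choice of Cb R M by <:].
HB.instance Definition _ := [SubChoice_isSubLmodule of Cb R M by <:].

Lemma Cb_continuous f : continuous f.
Proof. by have /bounded_continuousP[] := valP f. Qed.

Lemma Cb_bounded f : exists B, forall x, `|f x| <= B.
Proof. by have /bounded_continuousP[_ /bounded_funE] := valP f. Qed.

(* sup is 0 on the empty set, so this is also right when M is empty *)
Definition Cb_norm f : R := sup (range (fun x => `|f x|)).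

Lemma Cb_norm_ub f x : `|f x| <= Cb_norm f.
Proof.
apply: ub_le_sup; last by exists x.
by have [B fB] := Cb_bounded f; exists B => _ [y _ <-].
Qed.

Lemma Cb_norm_le f B : 0 <= B -> (forall x, `|f x| <= B) -> Cb_norm f <= B.
Proof.
move=> B0 fB; have [x0|M0] := pselect (exists x : M, True).
  apply: ge_sup; last by move=> _ [y _ <-].
  by case: x0 => x _; exists `|f x|, x.
rewrite /Cb_norm [X in sup X](_ : _ = set0) ?sup0//.
by rewrite -subset0 => ? [x _ _]; apply: M0; exists x.
Qed.

Lemma Cb_norm_ge0 f : 0 <= Cb_norm f.
Proof.
have [[x _]|M0] := pselect (exists x : M, True).
  exact: le_trans (Cb_norm_ub f x).
rewrite /Cb_norm [X in sup X](_ : _ = set0) ?sup0//.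
by rewrite -subset0 => ? [x _ _]; apply: M0; exists x.
Qed.

Lemma Cb_normD f g : Cb_norm (f + g) <= Cb_norm f + Cb_norm g.
Proof.
apply: Cb_norm_le => [|x]; first by rewrite addr_ge0// Cb_norm_ge0.
by rewrite (le_trans (ler_normD _ _))// lerD// Cb_norm_ub.
Qed.

Lemma Cb_normZ (a : R) f : Cb_norm (a *: f) = `|a| * Cb_norm f.
Proof.
have le b h : Cb_norm (b *: h) <= `|b| * Cb_norm h.
  apply: Cb_norm_le => [|x]; first by rewrite mulr_ge0// Cb_norm_ge0.
  by rewrite normrM ler_wpM2l// Cb_norm_ub.
apply/eqP; rewrite eq_le le/=.
have [->|a0] := eqVneq a 0; first by rewrite normr0 mul0r Cb_norm_ge0.
have := le a^-1 (a *: f); rewrite scalerA mulVf// scale1r normfV.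
by rewrite ler_pdivlMl// normr_gt0.
Qed.

Lemma Cb_norm_eq0 f : Cb_norm f = 0 -> f = 0.
Proof.
move=> f0; apply/val_inj/funext => x; apply/eqP.
by rewrite -normr_le0 -f0; exact: Cb_norm_ub.
Qed.

HB.instance Definition _ := @Lmodule_isNormed.Build R (Cb R M)
  Cb_norm Cb_normD Cb_normZ Cb_norm_eq0.

Lemma Cb_normE f : `|f| = sup (range (fun x => `|f x|)).
Proof. by []. Qed.

Lemma Cb_complete (F : set_system (Cb R M)) :
  ProperFilter F -> cauchy F -> cvg F.
Proof.
move=> FF /cauchy_ballP Fc.
have ev_le f g x : `|f x - g x| <= `|f - g| by exact: (Cb_norm_ub (f - g) x).
have Fcvg x : cvg ((fun f : Cb R M => f x) @ F).
  apply: R_complete; apply/cauchy_ballP => e e0.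
  have := Fc e e0; rewrite near_simpl => -[[A B] [FA FB] AB].
  exists ((fun f : Cb R M => f x) @` A, (fun f : Cb R M => f x) @` B).
    by split; [apply: filterS FA => f Af; exists f|
               apply: filterS FB => f Bf; exists f].
  move=> [_ _] [/= [f Af <-] [g Bg <-]].
  have := AB (f, g) (conj Af Bg).
  rewrite -ball_normE/= => h; rewrite -ball_normE/=.
  exact: le_lt_trans h.
pose l x : R := lim ((fun f : Cb R M => f x) @ F).
have close e : 0 < e ->
      \forall f \near F, forall x, `|l x - (f : Cb R M) x| <= e.
  move=> e0; have := Fc e e0; rewrite near_simpl => -[[A B] [FA FB] AB].
  apply: filterS FB => g Bg x.
  have h := @Fcvg x.
  have h' : (fun f : Cb R M => `|f x - g x|) @ F --> `|l x - g x|.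
    by apply: cvg_norm; apply: cvgB => //; exact: cvg_cst.
  apply: (closed_cvg (fun y : R => y <= e) _ _ _ h') => //.
  apply: filterS FA => f Af /=.
  have := AB (f, g) (conj Af Bg); rewrite -ball_normE/= => /ltW.
  exact: le_trans.
have lc : continuous l.
  move=> x; apply/cvgrPdist_lt => e e0.
  have e3 : 0 < e / 3 by rewrite divr_gt0.
  have [f lf] := filter_ex (close _ e3).
  have /cvgrPdist_lt/(_ _ e3) := @Cb_continuous f x.
  apply: filterS => y fxy.
  have -> : l x - l y = (l x - f x) + (f x - f y) + (f y - l y).
    by rewrite !addrA !subrK.
  rewrite (le_lt_trans (ler_normD _ _))// [ltRHS](_ : _ = e / 3 + e / 3 + e / 3).
    rewrite ltr_leD//; last by rewrite distrC.
    by rewrite (le_lt_trans (ler_normD _ _))// ler_ltD.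
  by rewrite -!mulrDl -mulr2n -mulrSr -(mulr_natr e) mulfK.
have lb : bounded_fun l.
  have [f lf] := filter_ex (close 1 ltr01).
  have [B fB] := Cb_bounded f.
  apply/bounded_funE; exists (1 + B) => x.
  by rewrite -(subrK (f x) (l x)) (le_trans (ler_normD _ _))// lerD.
have lP : l \in bounded_continuous by apply/bounded_continuousP.
apply/cvg_ex; exists (MkCb lP); apply/cvgrPdist_le => e e0.
apply: filterS (close _ e0) => f lf.
by apply: Cb_norm_le => //; exact: ltW.
Qed.

HB.instance Definition _ := Uniform_isComplete.Build (Cb R M) Cb_complete.

End Cb_normed.

Definition weakly_cvgn {R : realType} {X : normedModType R}
    (u : nat -> X) (l : X) :=
  forall phi : {linear X -> R}, continuous phi ->
    phi (u n) @[n --> \oo] --> phi l.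

(* The means are indexed by all N, the value at N = 0 being irrelevant to
   the limit; the subsequence is enumerated from k = 0. *)
Definition weakly_Banach_Saks {R : realType} (X : completeNormedModType R) :=
  forall (u : nat -> X) (l : X), weakly_cvgn u l ->
    exists2 s : nat -> nat, increasing_seq s &
      `|N%:R^-1 *: (\sum_(k < N) u (s k)) - l| @[N --> \oo] --> (0 : R).

Definition derived_set (M : topologicalType) (n : nat) : set M :=
  iter n (@limit_point M) [set: M].
Arguments derived_set : clear implicits.

Definition derived_set_omega (M : topologicalType) : set M :=
  \bigcap_(n in [set n | (1 <= n)%N]) derived_set M n.
Arguments derived_set_omega : clear implicits.

(* Main.v *)
From HB Require Import structures.
Require Import Defs.
From mathcomp Require Import all_boot all_order all_algebra.
From mathcomp Require Import all_classical all_reals all_analysis.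
From mathcomp Require Import ring lra zify.
Set Implicit Arguments.
Unset Strict Implicit.
Unset Printing Implicit Defensive.
Import Order.TTheory GRing.Theory Num.Theory.
Import numFieldNormedType.Exports.
Local Open Scope classical_set_scope.
Local Open Scope ring_scope.

(** If [M] is compact and its n-th derived set is empty, a weakly null sequence
    in [Cb R M] is bounded (gliding hump, against functionals that are weighted
    sums of point evaluations) and pointwise null, and it has a subsequence for
    which every point [x] sees at most n "big" terms, the k-th term being big at
    [x] when its modulus there is at least 2^-k: having i big terms among those
    already chosen forces [x] out of the (n - i)-th derived set, and this is
    preserved by making the next term small on a suitable finite set.  The
    partial sums of that subsequence are then uniformly bounded.

    Conversely, if all derived sets meet at a point, or if [M] is not compact,
    then [Cb R M] contains functions [f m] behaving like the unit vector basis
    of the Schreier space: at each point the supporting set of indices A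
    satisfies |A| <= min A, and each such A is attained.  They are weakly null,
    because every subsequence has convex combinations tending to 0 in norm, but
    no subsequence has Cesaro means tending to 0. *)

(** * Schreier families *)

Lemma linear_norm_bound (R : realType) (X : normedModType R)
    (phi : {linear X -> R}) : continuous phi ->
  exists2 C, 0 < C & forall v, `|phi v| <= C * `|v|.
Proof.
by move=> /linear_bounded_continuous/linear_boundedP/pinfty_ex_gt0.
Qed.

Lemma increasing_seq_ge (s : nat -> nat) n : increasing_seq s -> (n <= s n)%N.
Proof.
move=> /increasing_seqP sP; elim: n => // n IH.
by rewrite (leq_ltn_trans IH)//; have := sP n; rewrite ltEnat.
Qed.

Section schreier.
Context {R : realType} {M : topologicalType}.

Lemma Cb_sumE I (r : seq I) (P : pred I) (F : I -> Cb R M) x :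
  (\sum_(i <- r | P i) F i) x = \sum_(i <- r | P i) F i x.
Proof. exact: (big_morph (fun f : Cb R M => f x)). Qed.

Lemma Cb_of (f : M -> R) : continuous f -> (forall x, 0 <= f x <= 1) ->
  exists F : Cb R M, F =1 f.
Proof.
move=> fc f01.
have fP : f \in bounded_continuous.
  apply/bounded_continuousP; split => //; apply/bounded_funE; exists 1 => x.
  by have /andP[? ?] := f01 x; rewrite ger0_norm.
by exists (MkCb fP).
Qed.

(* Real-valued form of |A| <= min A for the set A of indices m with f m x != 0:
   k plays the role of min A, and the values being in [0, 1], the sum that of
   |A|. *)
Definition schreier_family (f : nat -> M -> R) :=
  [/\ forall m, continuous (f m),
      forall m x, 0 <= f m x <= 1,
      forall x, exists k, (forall m, (m < k)%N -> f m x = 0) /\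
        forall N, \sum_(0 <= m < N) f m x <= k%:R
    & forall A : seq nat, sorted ltn A -> all (leq (size A)) A ->
        exists x, forall m, m \in A -> f m x = 1].

Section weakly_null.
Variables (f : nat -> M -> R) (F : nat -> Cb R M).
Hypothesis fS : schreier_family f.
Hypothesis Ff : forall m, F m =1 f m.
Variables (phi : {linear Cb R M -> R}) (d : R) (P : pred nat).
Hypothesis Pphi : forall n, P n -> d <= `|phi (F n)|.
Hypothesis Pinf : forall N, exists2 n, (N <= n)%N & P n.

Lemma count_unbounded N K : exists2 N', (N <= N')%N &
  (K <= \sum_(N <= n < N') P n)%N.
Proof.
elim: K => [|K [N' NN' KN']]; first by exists N.
have [n N'n Pn] := Pinf N'; exists n.+1; first by rewrite (leq_trans NN')// leqW.
rewrite (big_cat_nat (n := N'))//= ?leqW//.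
rewrite -addn1 leq_add// big_nat_recr//= Pn.
exact: leq_addl.
Qed.

(* Each step adds the average of a block of signed bad functions so long that
   it is at most e / 2 at the points where h may be nonzero. *)
Lemma schreier_combination j e : 0 < e -> exists (h : Cb R M) (N : nat),
  [/\ j%:R * d <= phi h, forall x, `|h x| <= 1 + e
    & forall x, (forall n, (n < N)%N -> f n x = 0) -> h x = 0].
Proof.
have [fc f01 fk _] := fS.
elim: j e => [|j IH] e e0.
  exists 0, 0%N; split => //; first by rewrite mul0r linear0.
  by move=> x; rewrite normr0 addr_ge0// ltW.
have e20 : 0 < e / 2 by rewrite divr_gt0.
have [h [N [hphi hb h0]]] := IH _ e20.
(* [K] exceeds [2 N / e], so a total of at most [N] over the block, divided by its length [L >= K],
   is at most [e / 2]. *)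
pose K := (Num.bound (N%:R * 2 / e)).+1.
have [N' NN' KL] := count_unbounded N K.
set L := (\sum_(_ <= _ < _) _)%N in KL.
have L0 : 0 < L%:R :> R by rewrite ltr0n (leq_trans _ KL).
have LE : L%:R = \sum_(N <= n < N' | P n) 1 :> R.
  by rewrite /L natr_sum [RHS]big_mkcond; apply: eq_bigr => i _; case: (P i).
pose b : Cb R M := L%:R^-1 *: \sum_(N <= n < N' | P n)
  Num.sg (phi (F n)) *: F n.
have bphi : d <= phi b.
  rewrite /b linearZ/= linear_sum/= ler_pdivlMl// LE mulr_suml.
  rewrite ler_sum// => n Pn; rewrite mul1r linearZ/=.
  by have := Pphi Pn; rewrite normrEsg.
have bS x : `|b x| <= L%:R^-1 * \sum_(N <= n < N' | P n) f n x.
  rewrite /b /= normrM ger0_norm ?invr_ge0 ?ler0n//.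
  rewrite ler_wpM2l ?invr_ge0 ?ler0n// Cb_sumE.
  rewrite (le_trans (ler_norm_sum _ _ _))// ler_sum// => n Pn.
  have /andP[fn0 _] := f01 n x.
  rewrite /= normrM Ff (ger0_norm fn0) ler_piMl//.
  by rewrite normr_sg; case: eqP.
have b1 x : `|b x| <= 1.
  rewrite (le_trans (bS x))// ler_pdivrMl// mulr1 LE ler_sum// => n _.
  by have /andP[] := f01 n x.
exists (h + b), N'; split.
- by rewrite linearD/= -natr1 mulrDl mul1r lerD.
- move=> x; have [k [fk0 fkS]] := fk x.
  (* If [k >= N], every [f n] with [n < N] vanishes at [x], hence so does [h], and [b] alone is at
     most 1. If [k < N], the block sums to at most [k < N] at [x]. *)
  have [Nk|kN] := leqP N k.
    rewrite (_ : (h + b) x = b x); last first.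
      rewrite [LHS](_ : _ = h x + b x)// h0 ?add0r// => n nN.
      by rewrite fk0// (leq_trans nN).
    by rewrite (le_trans (b1 x))// lerDl ltW.
  rewrite [(h + b) x](_ : _ = h x + b x)// (le_trans (ler_normD _ _))//.
  rewrite (splitr e) addrA lerD// (le_trans (bS x))// ler_pdivrMl//.
  have kS : \sum_(N <= n < N' | P n) f n x <= k%:R.
    rewrite (le_trans _ (fkS N'))// [leRHS](big_cat_nat (n := N))//=.
    rewrite -[leLHS]add0r lerD//.
      by rewrite sumr_ge0// => n _; have /andP[] := f01 n x.
    rewrite big_mkcond/= ler_sum// => n _.
    by have /andP[] := f01 n x; case: ifP.
  rewrite (le_trans kS)// (@le_trans _ _ N%:R) ?ler_nat 1?ltnW//.
  have : N%:R * 2 / e <= L%:R.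
    rewrite (@le_trans _ _ K%:R) ?ler_nat//.
    by rewrite ltW// (lt_le_trans (archi_boundP _))// ?ler_nat// !mulr_ge0// invr_ge0 ltW.
  by rewrite ler_pdivrMr// mulrA ler_pdivlMr.
- move=> x f0; rewrite [(h + b) x](_ : _ = h x + b x)// h0 ?add0r.
    apply/eqP; rewrite -normr_le0 (le_trans (bS x))// big_nat_cond big1 ?mulr0//.
    by move=> n /andP[/andP[_ nN'] _]; exact: f0.
  by move=> n nN; apply: f0; exact: leq_trans NN'.
Qed.

End weakly_null.

(** If [|phi (F n)| >= d] infinitely often, [schreier_combination] yields for every [j] a function
    of norm at most 2 on which [phi] is at least [j * d], against the boundedness of [phi]. *)
Lemma schreier_weakly_null f (F : nat -> Cb R M) :
  schreier_family f -> (forall m, F m =1 f m) -> weakly_cvgn F 0.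
Proof.
move=> fS Ff phi phic; rewrite linear0; apply/cvgr0Pnorm_lt => d d0.
apply: contrapT => nP.
pose P n := d <= `|phi (F n)|.
have Pinf N : exists2 n, (N <= n)%N & P n.
  apply: contrapT => /forall2NP h; apply: nP; exists N => // n /= Nn.
  by have [//|/negP] := h n; rewrite -ltNge.
have [C C0 phiC] := linear_norm_bound phic.
have h j : j%:R * d <= C * 2.
  have [h [_ [hphi h2 _]]] := schreier_combination fS Ff (fun _ => id) Pinf j ltr01.
  rewrite (le_trans hphi)// (le_trans (ler_norm _))// (le_trans (phiC _))//.
  by rewrite ler_pM2l//; exact: Cb_norm_le.
have := h (Num.bound (C * 2 / d)); apply/negP; rewrite -ltNge -ltr_pdivrMr//.
by rewrite archi_boundP// !mulr_ge0// ?invr_ge0 ltW.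
Qed.

(** Positions [n] to [2 n - 1] of a subsequence carry [n] indices, all at least [n]. These terms
    equal 1 at a common point, where the mean of the first [2 n] terms is at least 1/2. *)
Lemma schreier_not_weakly_Banach_Saks f :
  schreier_family f -> ~ weakly_Banach_Saks (Cb R M).
Proof.
move=> fS wBS; have [fc f01 _ fA] := fS.
have [F Ff] : exists F : nat -> Cb R M, forall m, F m =1 f m.
  have /choice[F FE] : forall m, exists F : Cb R M, F =1 f m.
    by move=> m; exact: Cb_of.
  by exists F.
have [s s_incr /cvgr0Pnorm_lt/(_ (1 / 2))] := wBS _ _ (schreier_weakly_null fS Ff).
rewrite divr_gt0// => /(_ isT)[N _ hN].
have [n n0 Nn] : exists2 n, (0 < n)%N & (N <= n + n)%N.
  by exists N.+1 => //; lia.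
have := hN (n + n)%N; rewrite /= normr_id subr0.
move=> /(_ Nn); apply/negP; rewrite -leNgt.
have [x xA] : exists x, forall m, m \in map s (iota n n) -> f m x = 1.
  apply: fA; last first.
    rewrite size_map size_iota all_map; apply/allP => i /=.
    rewrite mem_iota => /andP[ni _].
    exact: leq_trans (increasing_seq_ge _ s_incr).
  rewrite sorted_map (@sub_sorted _ ltn)//; last exact: iota_ltn_sorted.
  by move=> i j ij; have := s_incr j i; rewrite leEnat /= !ltnNge => ->; rewrite -ltnNge.
apply: le_trans (Cb_norm_ub _ x).
apply: le_trans (ler_norm _).
rewrite [X in _ <= X](_ : _ = (n + n)%:R^-1 * \sum_(k < n + n) f (s k) x); last first.
  by congr (_ * _); rewrite [LHS]Cb_sumE; apply: eq_bigr => k _; rewrite Ff.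
rewrite ler_pdivlMl ?ltr0n ?addn_gt0 ?n0// -(big_mkord xpredT (fun k => f (s k) x)).
rewrite [leRHS](big_cat_nat (n := n))//= ?leq_addr//.
rewrite -[leLHS]add0r lerD//.
  by rewrite sumr_ge0// => i _; have /andP[] := f01 (s i) x.
rewrite big_nat (eq_bigr (fun=> 1)); last first.
  move=> i ni; apply: xA; apply: map_f; by rewrite mem_iota.
rewrite -big_nat sumr_const_nat addnK natrD; lra.
Qed.

End schreier.

(** * Schreier families from derived sets *)

Section metric.
Context {R : realType} {M : metricType R}.
Implicit Types (x y z : M) (U V W : set M).

Lemma mdist_continuous x : continuous (mdist x : M -> R).
Proof.
move=> y; apply/cvgrPdist_lt => e e0.
apply/metricType_numDomainType.nbhs_mdistP; exists e => //= z /= yz.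
have := metric_triangle x y z; have := metric_triangle x z y.
rewrite (metric_sym z y) ltr_norml => *; apply/andP; split; lra.
Qed.

Lemma open_ball_subset U x : open U -> U x ->
  exists2 r : R, 0 < r & forall y, mdist x y < r -> U y.
Proof.
move=> Uo Ux; have : nbhs x U by exact: open_nbhs_nbhs.
move=> /metricType_numDomainType.nbhs_mdistP[r r0 rU].
by exists r.
Qed.

(** A piecewise linear cutoff in the distance to [x]. The set [W] is there for [derived_set_tree],
    which builds the next level of its tree where the bump equals 1. *)
Lemma bump_function U x : open U -> U x -> exists b : M -> R, exists W,
  [/\ continuous b, forall y, 0 <= b y <= 1, forall y, ~ U y -> b y = 0
    & [/\ open W, W x, W `<=` U & forall y, W y -> b y = 1]].
Proof.
move=> Uo Ux; have [r r0 rU] := open_ball_subset Uo Ux.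
pose b y : R := Num.max 0 (Num.min 1 (2 - 2 / r * mdist x y)).
exists b, [set y | mdist x y < r / 2]; split.
- have <- : cst (0 : R^o) \max (cst (1 : R^o) \min
      (fun y => 2 - 2 / r * mdist x y)) = b by [].
  move=> y; apply: continuous_max; first exact: cvg_cst.
  apply: continuous_min; first exact: cvg_cst.
  apply: cvgB; first exact: cvg_cst.
  by apply: cvgMr; exact: mdist_continuous.
- move=> y; rewrite /b le_max lexx /= ge_max ler01 /= ge_min lexx//.
- move=> y Uy; rewrite /b max_l// ge_min; apply/orP; right.
  have ry : r <= mdist x y by rewrite leNgt; apply/negP => /rU.
  have : 1 <= mdist x y / r by rewrite ler_pdivlMr// mul1r.
  by rewrite mulrAC -mulrA; lra.
- split.
  + rewrite (_ : [set _ | _] = mdist x @^-1` [set t : R | t < r / 2])//.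
    by apply: open_comp; [move=> y _; exact: mdist_continuous|exact: open_lt].
  + by rewrite /= mdistxx divr_gt0.
  + by move=> y /= yr; apply: rU; lra.
  + move=> y /= yr; rewrite /b min_l ?max_r//.
    have : mdist x y / r <= 1 / 2 by rewrite ler_pdivrMr// mulrC mulrA mulr1; lra.
    by rewrite mulrAC -mulrA; lra.
Qed.

(** [E] varies with [n] to serve two uses: constant in [derived_set_tree], the n-th derived set in
    [schreier_of_derived_set_omega]. *)
Lemma limit_point_separation y (E : nat -> set M) U :
  open U -> U y -> (forall n, limit_point (E n) y) ->
  exists (z : nat -> M) (V : nat -> set M),
    [/\ forall n, E n (z n) /\ V n (z n), forall n, open (V n),
        forall n, V n `<=` U & forall i j x, V i x -> V j x -> i = j].
Proof.
move=> Uo Uy Ey; have [r r0 rU] := open_ball_subset Uo Uy.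
(* The premise [0 < nc.2] makes the choice total; [y] is a default value. *)
have /choice[g gP] : forall nc : nat * R, exists z,
    0 < nc.2 -> E nc.1 z /\ 0 < mdist y z < nc.2.
  move=> [n c] /=; have [c0|c0] := ltP 0 c; last by exists y.
  have [|z [zy Ez cz]] := Ey n [set z | mdist y z < c].
    by apply/metricType_numDomainType.nbhs_mdistP; exists c.
  by exists z => _; rewrite mdist_gt0 eq_sym zy.
(* [c n] bounds the distance [d n] of [z n] to [y]. Starting at [r / 2] keeps the outer radius
   [3 / 2 * d n] below [r]; the factor 1/3 puts each later outer radius below [d i / 2], the inner
   radius of annulus [i]. *)
pose c := fix c n := if n is n'.+1 then mdist y (g (n', c n')) / 3 else r / 2.
pose z n := g (n, c n); pose d n : R := mdist y (z n).
have c0 n : 0 < c n.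
  elim: n => [|n IH] /=; first by rewrite divr_gt0.
  by have [_ /andP[? _]] := gP (n, c n) IH; rewrite divr_gt0.
have zP n : E n (z n) /\ 0 < d n < c n by exact: gP (n, c n) (c0 n).
have cS n : c n.+1 = d n / 3 by [].
have cd i k : c (i + k.+1)%N <= d i / 3.
  elim: k => [|k IH]; first by rewrite addn1 cS.
  rewrite addnS cS; have [_ ?] := zP (i + k.+1)%N; lra.
(* disjoint annuli around y, as d decreases faster than 3^-n *)
exists z, (fun n => [set x | d n / 2 < mdist y x < 3 / 2 * d n]); split.
- by move=> n; have [? ?] := zP n; split => //=; rewrite -/(d n); lra.
- move=> n; rewrite (_ : [set _ | _] = mdist y @^-1`
    ([set t : R | d n / 2 < t] `&` [set t : R | t < 3 / 2 * d n])); last first.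
    by apply/seteqP; split => x /= /andP.
  apply: open_comp; first by move=> x _; exact: mdist_continuous.
  by apply: openI; [exact: open_gt|exact: open_lt].
- move=> n x /= /andP[_ xd]; apply: rU.
  have : c n <= r / 2.
    case: n {xd} => // n; have := cd 0%N n; rewrite add0n.
    by have [_] := zP 0%N; rewrite /c; lra.
  by have [_] := zP n; lra.
- have lt i j x : (i < j)%N -> d j / 2 < mdist y x < 3 / 2 * d j ->
      d i / 2 < mdist y x < 3 / 2 * d i -> False.
    move=> ij; have := cd i (j - i.+1)%N; rewrite addnS -addSn subnKC//.
    by have [_] := zP j; lra.
  move=> i j x /= Vi Vj; case: (ltngtP i j) => // ij; exfalso.
    exact: lt ij Vj Vi.
  exact: lt ij Vi Vj.
Qed.

(** * Gluing sequences of functions that live on disjoint sets *)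

Section glue.
Variables (V : nat -> set M) (e : nat -> nat -> M -> R).
Hypothesis Vdisj : forall i j x, V i x -> V j x -> i = j.
Hypothesis e0 : forall j m x, ~ V j x -> e j m x = 0.

(* Only finitely many pieces contribute to each index m, so that continuity
   needs no local finiteness of V. *)
Definition glue m x := \sum_(0 <= j < m.+1) e j m x.

(** The truncation at [m] kills the indices below [j] on [V j]. This is harmless in
    [derived_set_tree], where [j] is a least element, and yields the bound on the least index in
    [schreier_of_derived_set_omega]. *)
Lemma glue_in j m x : V j x -> glue m x = if (j <= m)%N then e j m x else 0.
Proof.
move=> Vjx; rewrite /glue; case: ifPn => jm.
  rewrite (bigD1_seq j) ?mem_index_iota ?iota_uniq//= big1 ?addr0// => i ij.
  by apply: e0 => Vix; rewrite (Vdisj Vix Vjx) eqxx in ij.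
rewrite big_nat big1// => i /andP[_ im]; apply: e0 => Vix.
by rewrite -(Vdisj Vix Vjx) -ltnS im in jm.
Qed.

Lemma glue_out m x : (forall j, ~ V j x) -> glue m x = 0.
Proof. by move=> Vx; rewrite /glue big1// => i _; exact: e0. Qed.

Lemma glue_continuous m : (forall j, continuous (e j m)) -> continuous (glue m).
Proof.
move=> ec; rewrite /glue.
by apply: continuous_big => // -[a b]; exact: add_continuous.
Qed.

Lemma glue_itv m x : (forall j, 0 <= e j m x <= 1) -> 0 <= glue m x <= 1.
Proof.
move=> e01; have [[j Vj]|Vx] := pselect (exists j, V j x).
  by rewrite (glue_in _ Vj); case: ifP; rewrite ?lexx ?ler01.
rewrite glue_out ?lexx ?ler01// => j Vj; apply: Vx; by exists j.
Qed.

End glue.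

(** The tree of all index sets of size [n]: the children of a node sit at points of rank one less
    accumulating at it, and a branch lists its set in increasing order. Rank [n] leaves room for [n]
    levels. *)
Lemma derived_set_tree n y U : derived_set M n y -> open U -> U y ->
  exists g : nat -> M -> R,
  [/\ forall m, continuous (g m), forall m x, 0 <= g m x <= 1,
      forall m x, ~ U x -> g m x = 0,
      forall x N, \sum_(0 <= m < N) g m x <= n%:R
    & forall A, sorted ltn A -> size A = n ->
        exists2 x, U x & forall m, m \in A -> g m x = 1].
Proof.
elim: n y U => [|n IH] y U ny Uo Uy.
  exists (fun _ _ => 0); split => //.
  - by move=> m; exact: cst_continuous.
  - by move=> *; rewrite lexx ler01.
  - by move=> x N; rewrite big1.
  - by move=> A _ /size0nil ->; exists y.
have [z [V [zEV Vo VU Vdisj]]] := limit_point_separation Uo Uy (fun _ => ny).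
have /choice[bW bWP] : forall j, exists bW : (M -> R) * (set M),
    [/\ continuous bW.1, forall y, 0 <= bW.1 y <= 1,
        forall y, ~ V j y -> bW.1 y = 0
      & [/\ open bW.2, bW.2 (z j), bW.2 `<=` V j
          & forall y, bW.2 y -> bW.1 y = 1]].
  move=> j; have [_ Vz] := zEV j.
  by have [b [W bW]] := bump_function (Vo j) Vz; exists (b, W).
have /choice[g gP] : forall j, exists g : nat -> M -> R,
    [/\ forall m, continuous (g m), forall m x, 0 <= g m x <= 1,
      forall m x, ~ (bW j).2 x -> g m x = 0,
      forall x N, \sum_(0 <= m < N) g m x <= n%:R
    & forall A, sorted ltn A -> size A = n ->
        exists2 x, (bW j).2 x & forall m, m \in A -> g m x = 1].
  move=> j; have [_ _ _ [Wo Wz _ _]] := bWP j; have [Ez _] := zEV j.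
  exact: IH Ez Wo Wz.
(* V j hosts the sets of indices with least element j *)
pose e j m := if m == j then (bW j).1 else g j m.
have e0 j m x : ~ V j x -> e j m x = 0.
  move=> Vx; have [_ _ b0 [_ _ WV _]] := bWP j; have [_ _ g0 _ _] := gP j.
  by rewrite /e; case: ifP => _; [exact: b0|apply: g0 => /WV].
have e01 j m x : 0 <= e j m x <= 1.
  by rewrite /e; case: ifP => _; [case: (bWP j)|case: (gP j)].
exists (glue e); split.
- move=> m; apply: glue_continuous => j; rewrite /e.
  by case: ifP => _; [case: (bWP j)|case: (gP j)].
- by move=> m x; apply: (glue_itv Vdisj e0).
- move=> m x Ux; apply: (glue_out e0) => j /VU; exact: Ux.
- move=> x N; have [[j Vj]|Vx] := pselect (exists j, V j x); last first.
    rewrite big1// => m _; apply: (glue_out e0) => j Vj; apply: Vx; by exists j.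
  have [_ g01 _ gn _] := gP j.
  (* On [V j] the bump of index [j] contributes at most 1 and the subtree at most [n]. *)
  rewrite (@le_trans _ _ (\sum_(0 <= m < N) ((m == j)%:R + g j m x)))//.
    apply: ler_sum => m _; have /andP[? _] := g01 m x.
    rewrite (glue_in Vdisj e0 _ Vj) /e; have [->|mj] := eqVneq m j.
      have [_ /(_ x)/andP[_ b1] _ _] := bWP j.
      rewrite leqnn/= (le_trans b1)// lerDl.
      by have /andP[] := g01 j x.
    by rewrite add0r; case: ifP.
  rewrite big_split/= -nat1r lerD//.
  rewrite (eq_bigr (fun m => if m == j then 1 else 0)); last first.
    by move=> m _; case: ifP.
  rewrite -big_mkcond big_nat1_eq; case: ifP => //.
(* The least element [j] selects the piece; the point found for the rest [A] lies where the bump of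
   [j] equals 1. *)
- move=> [//|j A] /= jA [sA].
  have [_ _ _ _ /(_ A (path_sorted jA) sA)[x Wx gx]] := gP j.
  have [_ _ _ [_ _ WV W1]] := bWP j.
  exists x; first exact/(VU j)/WV.
  move=> m; rewrite (glue_in Vdisj e0 _ (WV _ Wx)) inE /e.
  have [->|mj] := eqVneq m j; first by rewrite leqnn W1.
  move=> /= mA; rewrite gx//.
  by have /allP/(_ _ mA)/ltnW -> := order_path_min ltn_trans jA.
Qed.

(** Piece [n] carries the tree of depth [n], and only for indices at least [n], so a point of it
    satisfies the Schreier bound with [k = n]. A set [A] is attained in the piece numbered by its
    size. *)
Lemma schreier_of_derived_set_omega : derived_set_omega M !=set0 ->
  exists f : nat -> M -> R, schreier_family f.
Proof.
move=> [y yw].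
have yl n : limit_point (derived_set M n) y by exact: (yw n.+1).
have [z [V [zEV Vo _ Vdisj]]] :=
  limit_point_separation openT (I : setT y) yl.
have /choice[g gP] := fun n => derived_set_tree (zEV n).1 (Vo n) (zEV n).2.
have e0 j m x : ~ V j x -> g j m x = 0 by case: (gP j) => _ _ h _ _; exact: h.
exists (glue g); split.
- by move=> m; apply: glue_continuous => j; case: (gP j).
- by move=> m x; apply: (glue_itv Vdisj e0) => j; case: (gP j).
- move=> x; have [[j Vj]|Vx] := pselect (exists j, V j x); last first.
    exists 0%N; split => // N; rewrite big1// => m _.
    by apply: (glue_out e0) => j Vj; apply: Vx; exists j.
  exists j; split => [m mj|N].
    by rewrite (glue_in Vdisj e0 _ Vj) leqNgt mj.
  have [_ g01 _ gj _] := gP j; apply: le_trans (gj x N).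
  apply: ler_sum => m _; rewrite (glue_in Vdisj e0 _ Vj).
  by case: ifP => // _; case/andP: (g01 m x).
- move=> A As /allP Aall; have [_ _ _ _ gA] := gP (size A).
  have [x Vx gx] := gA _ As erefl; exists x => m mA.
  by rewrite (glue_in Vdisj e0 _ Vx) Aall// gx.
Qed.

End metric.

(** * Schreier families on noncompact spaces *)

(** Dependent choice in which each new term may be constrained by the list of all earlier ones. *)
Lemma history_choice T (P : seq T -> T -> Prop) :
  (forall s, exists t, P s t) -> exists f : nat -> T, forall n, P (mkseq f n) (f n).
Proof.
move=> /choice[c cP].
pose h := fix h n := if n is n'.+1 then rcons (h n') (c (h n')) else [::].
have hE n : h n = mkseq (c \o h) n.
  by elim: n => // n IH; rewrite mkseqS -IH.
by exists (c \o h) => n; rewrite -hE; exact: cP.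
Qed.

Lemma inv_nat_le (R : realType) (r : R) n : 0 < r ->
  (Num.bound r^-1 <= n)%N -> n%:R^-1 <= r.
Proof.
move=> r0 rn; have rV0 : 0 < r^-1 by rewrite invr_gt0.
have rVn : r^-1 < n%:R.
  by apply: (lt_le_trans (archi_boundP (ltW rV0))); rewrite ler_nat.
by rewrite -[leRHS]invrK ltW// ltf_pV2 ?posrE// (lt_trans rV0 rVn).
Qed.

Section noncompact.
Context {R : realType} {M : metricType R}.

(** Suppose every sequence clusters, but some filter [F] does not. Each point then keeps a positive
    distance from some member of [F]; this distance can be made uniform, and greedy choices give a
    [d]-separated sequence, which cannot cluster. *)
Lemma noncompact_sequence : ~ compact [set: M] -> exists x : nat -> M,
  forall y, exists r N, 0 < r /\ forall i, (N <= i)%N -> r <= mdist y (x i).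
Proof.
apply: contra_notP => /forallNP noseq.
have clus (x : nat -> M) : exists y, forall r N, 0 < r ->
    exists2 i, (N <= i)%N & mdist y (x i) < r.
  apply: contrapT => /forallNP h; apply: (noseq x) => y.
  apply: contrapT => /forallNP hy; apply: (h y) => r N r0.
  apply: contrapT => /forall2NP hi; apply: (hy r); exists N; split => // i Ni.
  by have [//|/negP] := hi i; rewrite -leNgt.
move=> F FF _; apply: contrapT => /set0P/negP/negPn/eqP F0.
have far y : exists2 r : R, 0 < r & exists2 A, F A &
    forall z, A z -> r <= mdist y z.
  apply: contrapT => /forall2NP h.
  suff : ([set: M] `&` cluster F) y by rewrite F0.
  split => // A B FA /metricType_numDomainType.nbhs_mdistP[r /= r0 rB].
  have [//|hA] := h r; apply: contrapT => AB; apply: hA; exists A => // z Az.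
  by rewrite leNgt; apply/negP => yz; apply: AB; exists z; split => //; exact: rB.
(* A Lebesgue number argument: otherwise there are points [x n] that every member of [F] approaches
   within [1 / (n + 1)], and a cluster point of them contradicts [far]. *)
have [d d0 dP] : exists2 d : R, 0 < d & forall y, exists2 A, F A &
    forall z, A z -> d <= mdist y z.
  apply: contrapT => /forall2NP h.
  have /choice[x xP] : forall n : nat, exists x, forall A, F A ->
      exists2 z, A z & mdist x z < n.+1%:R^-1.
    move=> n; have [|/existsNP[x hx]] := h n.+1%:R^-1; first by rewrite invr_gt0.
    exists x => A FA; apply: contrapT => /forall2NP hz; apply: hx.
    by exists A => // z Az; have [//|/negP] := hz z; rewrite -leNgt.
  have [y yx] := clus x; have [r r0 [A FA yA]] := far y.
  have r20 : 0 < r / 2 by rewrite divr_gt0.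
  have [i Ni yxi] := yx (r / 2) (Num.bound (r / 2)^-1) r20.
  have [z Az xz] := xP i _ FA.
  have ir : i.+1%:R^-1 <= r / 2.
    by apply: inv_nat_le => //; exact: leqW.
  have := lt_le_trans xz ir.
  have := metric_triangle y (x i) z; have := yA _ Az; lra.
have /history_choice[x xP] : forall s : seq M, exists t,
    forall y, y \in s -> d <= mdist y t.
  move=> s; have : exists2 A, F A & forall y, y \in s -> forall z, A z -> d <= mdist y z.
    elim: s => [|y s [A FA sA]]; first by exists setT => //; exact: filterT.
    have [B FB yB] := dP y; exists (A `&` B); first exact: filterI.
    by move=> z; rewrite inE => /predU1P[->|/sA zA] t [At Bt]; [exact: yB|exact: zA].
  by case=> A FA sA; have [t At] := filter_ex FA; exists t => y /sA; exact.
have [y yx] := clus x.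
have d20 : 0 < d / 2 by rewrite divr_gt0.
have [i _ xi] := yx (d / 2) 0%N d20.
have [j ij xj] := yx (d / 2) i.+1 d20.
have : d <= mdist (x i) (x j).
  by apply: xP; apply: map_f; rewrite mem_iota.
have := metric_triangle (x i) y (x j); rewrite (metric_sym (x i) y); lra.
Qed.

Definition locally_finite_family (V : nat -> set M) :=
  forall y : M, exists (W : set M) N,
  nbhs y W /\ forall i z, (N <= i)%N -> W z -> ~ V i z.

Lemma noncompact_disjoint_family : ~ compact [set: M] ->
  exists (z : nat -> M) (V : nat -> set M),
    [/\ forall i, V i (z i), forall i, open (V i),
        forall i j x, V i x -> V j x -> i = j & locally_finite_family V].
Proof.
move=> /noncompact_sequence[x xP].
have /choice[rN rNP] : forall y, exists rN : R * nat,
    0 < rN.1 /\ forall i, (rN.2 <= i)%N -> rN.1 <= mdist y (x i).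
  by move=> y; have [r [N ?]] := xP y; exists (r, N).
(* [idx] skips far enough that all later centres stay at distance [r] from [z k], with [r] the first
   component of [rN (z k)]. The radii decrease and are at most [r / 2], for disjointness, and tend
   to 0, for local finiteness. *)
pose idx := fix idx k := if k is k'.+1
  then maxn (idx k').+1 (rN (x (idx k'))).2 else 0%N.
pose z k := x (idx k).
pose rad := fix rad k := if k is k'.+1
  then Num.min (rad k') (Num.min ((rN (z k)).1 / 2) k.+1%:R^-1)
  else (rN (z 0%N)).1 / 2.
have rad0 k : 0 < rad k.
  have rN0 i : 0 < (rN (z i)).1 / 2 by rewrite divr_gt0//; case: (rNP (z i)).
  by elim: k => [|k IH] /=; rewrite ?rN0// !lt_min IH rN0 invr_gt0 ltr0n.
have rad_rho k : rad k <= (rN (z k)).1 / 2.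
  by case: k => [|k] /=; rewrite ?lexx// !ge_min lexx /= orbT.
have rad_inv k : (0 < k)%N -> rad k <= k.+1%:R^-1.
  by case: k => [//|k] _; rewrite /= !ge_min lexx !orbT.
have rad_le j k : (j <= k)%N -> rad k <= rad j.
  move=> /subnK <-; elim: (k - j)%N => // i IH; rewrite addSn.
  by apply: le_trans IH; rewrite /= ge_min lexx.
have idx_lt j k : (j < k)%N -> (maxn (idx j).+1 (rN (z j)).2 <= idx k)%N.
  move=> /subnK <-; elim: (k - _)%N => // i IH.
  by rewrite addSn (leq_trans IH)//= leq_max leqnSn.
have idx_ge k : (k <= idx k)%N.
  by elim: k => // k IH; rewrite (leq_ltn_trans IH)//= leq_max leqnn.
have sep j k : (j < k)%N -> rad j + rad k <= mdist (z j) (z k).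
  move=> jk; have [_ /(_ (idx k))] := rNP (z j).
  have := idx_lt _ _ jk; rewrite geq_max => /andP[_ ->] /(_ isT).
  by have := rad_rho j; have := rad_le _ _ (ltnW jk); rewrite -/(z k); lra.
have disj j k y : (j < k)%N -> mdist (z j) y < rad j -> mdist (z k) y < rad k -> False.
  move=> jk; have := sep _ _ jk; have := metric_triangle (z j) y (z k).
  by rewrite (metric_sym y (z k)); lra.
exists z, (fun k => [set y | mdist (z k) y < rad k]); split.
- by move=> i /=; rewrite mdistxx.
- move=> i; rewrite (_ : [set _ | _] = mdist (z i) @^-1` [set t : R | t < rad i])//.
  by apply: open_comp; [move=> y _; exact: mdist_continuous|exact: open_lt].
- move=> i j y /= Vi Vj; case: (ltngtP i j) => // ij; exfalso.
    exact: disj ij Vi Vj.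
  exact: disj ij Vj Vi.
- move=> y; have [r0 ry] := rNP y; set r := (rN y).1 in r0 ry.
  have r20 : 0 < r / 2 by rewrite divr_gt0.
  (* Beyond this index the centres are at least [r] away from [y] and the radii at most [r / 2]. *)
  exists [set t | mdist y t < r / 2], (maxn (rN y).2 (Num.bound (r / 2)^-1).+1).
  split; first by apply/metricType_numDomainType.nbhs_mdistP; exists (r / 2).
  move=> i t /=; rewrite geq_max => /andP[Ni bi] yt it.
  have ir : i.+1%:R^-1 <= r / 2.
    by apply: inv_nat_le => //; lia.
  have i0 : (0 < i)%N by lia.
  have := ry _ (leq_trans Ni (idx_ge i)); rewrite -/(z i).
  have := metric_triangle y t (z i); rewrite (metric_sym t).
  by have := le_trans (rad_inv _ i0) ir; lra.
Qed.

(** Unlike in [glue], infinitely many pieces may carry one index. The sum is truncated at a bound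
    depending on the point, and near each point it agrees with a fixed finite sum. *)
Lemma locally_finite_sum (V : nat -> set M) (e : nat -> M -> R) (c : nat -> bool) :
  (forall i j x, V i x -> V j x -> i = j) -> locally_finite_family V ->
  (forall i, continuous (e i)) -> (forall i x, ~ V i x -> e i x = 0) ->
  exists f : M -> R, [/\ continuous f,
    forall i x, V i x -> f x = (c i)%:R * e i x
    & forall x, (forall i, ~ V i x) -> f x = 0].
Proof.
move=> Vdisj Vlf ec e0.
have /choice[WN WNP] : forall y : M, exists WN : set M * nat, nbhs y WN.1 /\
    forall i z, (WN.2 <= i)%N -> WN.1 z -> ~ V i z.
  by move=> y; have [W [N ?]] := Vlf y; exists (W, N).
pose g n x : R := \sum_(0 <= i < n) (c i)%:R * e i x.
have gV n j x : V j x -> (j < n)%N -> g n x = (c j)%:R * e j x.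
  move=> Vj jn; rewrite /g (bigD1_seq j) ?mem_index_iota ?iota_uniq//=.
  rewrite big1 ?addr0// => i ij.
  by rewrite e0 ?mulr0// => Vi; rewrite (Vdisj _ _ _ Vi Vj) eqxx in ij.
have g0 n x : (forall i, ~ V i x) -> g n x = 0.
  by move=> Vx; rewrite /g big1// => i _; rewrite e0 ?mulr0.
have lt j x y : (WN x).1 y -> V j y -> (j < (WN x).2)%N.
  by move=> Wy Vj; rewrite ltnNge; apply/negP => /((WNP x).2 _ y)/(_ Wy).
have self x : (WN x).1 x by apply: nbhs_singleton; case: (WNP x).
exists (fun x => g (WN x).2 x); split.
- move=> x; have gc : continuous (g (WN x).2).
    apply: continuous_big => [[a b]|i _]; first exact: add_continuous.
    by move=> y; apply: cvgMr; exact: ec.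
  apply: cvg_trans (gc x); apply: near_eq_cvg.
  apply: filterS (WNP x).1 => y Wy.
  have [[j Vj]|Vy] := pselect (exists j, V j y).
    by rewrite !(gV _ _ _ Vj)//; exact: lt Vj.
  by rewrite !g0// => j Vj; apply: Vy; exists j.
- by move=> j x Vj; rewrite (gV _ _ _ Vj)//; exact: lt Vj.
- by move=> x Vx; exact: g0.
Qed.

Lemma schreier_of_noncompact : ~ compact [set: M] ->
  exists f : nat -> M -> R, schreier_family f.
Proof.
move=> /noncompact_disjoint_family[z [V [Vz Vo Vdisj Vlf]]].
have /choice[e eP] : forall i, exists e : M -> R,
    [/\ continuous e, forall x, 0 <= e x <= 1, forall x, ~ V i x -> e x = 0
      & e (z i) = 1].
  move=> i; have [e [W [? ? ? [_ Wz _ W1]]]] := bump_function (Vo i) (Vz i).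
  by exists e; split => //; exact: W1.
(* the i-th disjoint open set hosts the i-th finite set of indices *)
pose A i : seq nat := odflt [::] (unpickle i).
pose good i := sorted ltn (A i) && all (leq (size (A i))) (A i).
have /choice[f fP] := fun m => locally_finite_sum (fun i => good i && (m \in A i))
  Vdisj Vlf (fun i => let: And4 ec _ _ _ := eP i in ec)
  (fun i => let: And4 _ _ e0 _ := eP i in e0).
have fV m i x : V i x -> f m x = (good i && (m \in A i))%:R * e i x.
  by have [_ h _] := fP m; exact: h.
have f0 m x : ~ (exists i, V i x) -> f m x = 0.
  by have [_ _ h] := fP m => Vx; apply: h => i Vi; apply: Vx; exists i.
exists f; split.
- by move=> m; case: (fP m).
- move=> m x; have [[i Vi]|Vx] := pselect (exists i, V i x); last first.
    by rewrite f0// lexx ler01.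
  have [_ e01 _ _] := eP i.
  rewrite (fV _ _ _ Vi); case: (good i && _); first by rewrite mul1r.
  by rewrite mul0r lexx ler01.
- move=> x; have [[i Vi]|Vx] := pselect (exists i, V i x); last first.
    by exists 0%N; split => // N; rewrite big1// => m _; rewrite f0.
  have [_ /(_ x)/andP[e0 e1] _ _] := eP i.
  have [gi|gi] := boolP (good i); last first.
    exists 0%N; split => // N; rewrite big1// => m _.
    by rewrite (fV _ _ _ Vi) (negbTE gi) mul0r.
  (* [x] sees only indices in [A i]: they are at least its size, and there are that many. *)
  exists (size (A i)); split => [m mA|N].
    rewrite (fV _ _ _ Vi) gi; have [mi|_] := boolP (m \in A i); last by rewrite mul0r.
    by move: gi => /andP[_ /allP/(_ _ mi)]; rewrite leqNgt mA.
  rewrite (@le_trans _ _ (\sum_(0 <= m < N) (m \in A i)%:R))//.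
    by apply: ler_sum => m _; rewrite (fV _ _ _ Vi) gi/= ler_piMr.
  rewrite -natr_sum ler_nat (eq_bigr (fun m => if m \in A i then 1 else 0)%N);
    last by move=> m _; case: ifP.
  rewrite -big_mkcond -big_filter sum1_size; apply: uniq_leq_size.
    by rewrite filter_uniq// iota_uniq.
  by move=> m; rewrite mem_filter => /andP[].
- move=> B Bs Bk; exists (z (pickle B)) => m mB.
  rewrite (fV _ _ _ (Vz _)) /good /A pickleK /= Bs Bk mB mul1r.
  by case: (eP (pickle B)).
Qed.

End noncompact.

(** * Weakly null sequences are bounded *)

Lemma weakly_cvgn_apply (R : realType) (X : normedModType R) (u : nat -> X) l
    (phi : X -> R) C : scalar phi -> (forall v, `|phi v| <= C * `|v|) ->
  weakly_cvgn u l -> phi (u n) @[n --> \oo] --> phi l.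
Proof.
move=> philin phiC ul.
pose L : {linear X -> R} := HB.pack phi (GRing.isLinear.Build R X R _ phi philin).
apply: (ul L); apply/linear_bounded_continuous/linear_boundedP.
near=> r => x; apply: le_trans (phiC x) _; rewrite ler_wpM2r//.
Unshelve. all: by end_near. Qed.

Section uniform_boundedness.
Context {R : realType} {M : topologicalType}.
Implicit Types (f g : Cb R M) (x : nat -> M).

Lemma weakly_cvgn_pointwise (u : nat -> Cb R M) l (y : M) :
  weakly_cvgn u l -> u n y @[n --> \oo] --> l y.
Proof.
apply: (@weakly_cvgn_apply _ _ u l (fun f : Cb R M => f y) 1) => //.
by move=> f; rewrite mul1r; exact: Cb_norm_ub.
Qed.

(** With ratio 1/4 the weights after [w k] sum to at most [w k / 3], half of what a hump of relative
    height 2/3 contributes at [x k]. *)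
Let w k : R := 4^-1 ^+ k.

Lemma sum_geometric4 m n : (m <= n)%N ->
  \sum_(m <= k < n) w k = 4 / 3 * (w m - w n).
Proof.
move=> mn; rewrite -[w m - w n]opprB -(telescope_sumr _ mn) mulrN -mulNr mulr_sumr.
by apply: eq_bigr => k _; rewrite /w exprS; lra.
Qed.

Lemma w_gt0 k : 0 < w k. Proof. by rewrite exprn_gt0// invr_gt0. Qed.

Lemma sum_weight_le m n : \sum_(m <= k < n) w k <= 4 / 3 * w m.
Proof.
have [mn|nm] := leqP m n.
  by rewrite sum_geometric4//; have := w_gt0 n; lra.
by rewrite big_geq ?(ltnW nm)// mulr_ge0// ltW// w_gt0.
Qed.

Definition atoms x f n := \sum_(0 <= k < n) w k * f (x k).

Lemma atoms_tail_le x f c m n : (forall k, (m <= k < n)%N -> `|f (x k)| <= c) ->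
  0 <= c -> `|\sum_(m <= k < n) w k * f (x k)| <= 4 / 3 * w m * c.
Proof.
move=> fc c0; apply: le_trans (ler_wpM2r c0 (sum_weight_le m n)).
rewrite mulr_suml (le_trans (ler_norm_sum _ _ _))//.
rewrite big_nat [leRHS]big_nat; apply: ler_sum => k /fc kc.
by rewrite normrM (gtr0_norm (w_gt0 _)) ler_pM2l ?w_gt0.
Qed.

Lemma atoms_cvg x f : cvgn (atoms x f).
Proof.
apply: (@normed_cvg _ _ (fun k => w k * f (x k))).
apply: nondecreasing_is_cvgn.
  by apply: nondecreasing_series => k _ _ /=.
exists (4 / 3 * `|f|) => _ [n _ <-].
rewrite /series/=.
have := ler_wpM2r (normr_ge0 f) (sum_weight_le 0 n).
rewrite /w expr0 mulr1 -/w mulr_suml; apply: le_trans.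
apply: ler_sum => k _; rewrite normrM (gtr0_norm (w_gt0 _)) ler_pM2l ?w_gt0//.
exact: Cb_norm_ub.
Qed.

(** Integration against the discrete measure with mass [w k] at [x k]. *)
Definition atomic x f := limn (atoms x f).

Lemma atomic_scalar x : scalar (atomic x).
Proof.
move=> a f g; apply/cvg_lim => //.
rewrite (_ : atoms x _ = (a *: atoms x f + atoms x g : nat -> R^o)); last first.
  apply/funext => n; rewrite /atoms /= [RHS](_ : _ = a * atoms x f n + atoms x g n)//.
  rewrite mulr_sumr -big_split/=; apply: eq_bigr => k _.
  by rewrite mulrCA -mulrDr.
by apply: cvgD; [apply: cvgZr; exact: atoms_cvg|exact: atoms_cvg].
Qed.

Lemma atomic_bound x f : `|atomic x f| <= 4 / 3 * `|f|.
Proof.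
have h : `|atoms x f n| @[n --> \oo] --> `|atomic x f|.
  by apply: cvg_norm; exact: atoms_cvg.
apply: (closed_cvg (fun y : R => y <= 4 / 3 * `|f|) _ _ _ h) => //.
near=> n; have := @atoms_tail_le x f `|f| 0 n (fun k _ => Cb_norm_ub f (x k)).
by rewrite /w expr0 mulr1; apply.
Unshelve. all: by end_near. Qed.

Lemma weakly_null_bounded (v : nat -> Cb R M) : weakly_cvgn v 0 ->
  exists2 B, 0 <= B & forall n y, `|v n y| <= B.
Proof.
move=> v0; suff [B vB] : exists B, forall n, `|v n| <= B.
  exists B => [|n y]; first exact: le_trans (vB 0%N).
  exact: le_trans (Cb_norm_ub _ _) (vB n).
apply: contrapT => /forallNP unb.
have vtail B N : exists2 n, (N <= n)%N & B <= `|v n|.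
  (* Adding the norms of the first [N] terms to the bound forces the index past [N]. *)
  have /existsNP[n /negP] := unb (`|B| + \sum_(0 <= n < N) `|v n|).
  rewrite -ltNge => Bn; exists n; last first.
    rewrite (le_trans (ler_norm B))// ltW// (le_lt_trans _ Bn)// lerDl sumr_ge0//.
  rewrite leqNgt; apply/negP => nN; move: Bn; apply/negP; rewrite -leNgt.
  rewrite (bigD1_seq n) ?mem_index_iota ?iota_uniq//= addrCA lerDl addr_ge0//.
  by rewrite sumr_ge0.
(* At stage [k] the earlier atoms contribute at most 4/3, the new one at least [2 / 3 * w k * |f|],
   the later ones at most half of that. What remains is at least [(3 k + 4) / 3 - 4 / 3 = k]. *)
have /history_choice[h hP] : forall s : seq (nat * M), exists nx : nat * M,
    [/\ forall py, py \in s -> `|v nx.1 py.2| <= 1,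
        3 * (size s)%:R + 4 <= w (size s) * `|v nx.1|
      & 2 / 3 * `|v nx.1| <= `|v nx.1 nx.2|].
  move=> s; have [N _ NP] : \forall n \near \oo, forall py, py \in s -> `|v n py.2| <= 1.
    elim: s => [|py s IH]; first by near=> n.
    have /cvgr0Pnorm_le/(_ _ ltr01) := @weakly_cvgn_pointwise _ _ py.2 v0.
    move: IH; apply: filterS2 => n sn pn qy; rewrite inE => /predU1P[->|]//.
    exact: sn.
  have [n Nn vn] := vtail ((3 * (size s)%:R + 4) / w (size s)) N.
  have sn : 3 * (size s)%:R + 4 <= w (size s) * `|v n|.
    by rewrite -ler_pdivrMl ?w_gt0// mulrC.
  have [y vy] : exists y, 2 / 3 * `|v n| <= `|v n y|.
    apply: contrapT => /forallNP vy.
    have vn0 : 0 < `|v n|.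
      rewrite (lt_le_trans _ vn)// divr_gt0 ?w_gt0// ltr_wpDl ?mulr_ge0//.
    have : `|v n| <= 2 / 3 * `|v n|.
      apply: Cb_norm_le => [|y]; first by rewrite mulr_ge0.
      by rewrite ltW// ltNge; apply/negP; exact: vy.
    by lra.
  by exists (n, y); split => //; exact: NP.
pose x k := (h k).2.
have large k : k%:R <= `|atomic x (v (h k).1)|.
  set f := v (h k).1.
  have [fs ] := hP k; rewrite -/f size_mkseq => fk fx.
  have nf : `|atoms x f n| @[n --> \oo] --> `|atomic x f|.
    by apply: cvg_norm; exact: atoms_cvg.
  apply: (closed_cvg (fun y : R => k%:R <= y) _ _ _ nf) => //.
  near=> n.
  have kn : (k < n)%N by near: n; exact: nbhs_infty_gt.
  rewrite /atoms (big_cat_nat (n := k))//= ?(ltnW kn)// (big_ltn kn).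
  have h1 : `|\sum_(0 <= j < k) w j * f (x j)| <= 4 / 3.
    have -> : 4 / 3 = 4 / 3 * w 0 * 1 by rewrite /w expr0 !mulr1.
    apply: atoms_tail_le => // j jk; apply: (fs (h j)).
    by apply: map_f; rewrite mem_iota.
  have h2 : `|\sum_(k.+1 <= j < n) w j * f (x j)| <= 4 / 3 * w k.+1 * `|f|.
    by apply: atoms_tail_le => // j _; exact: Cb_norm_ub.
  have h3 : 2 / 3 * (w k * `|f|) <= `|w k * f (x k)|.
    by rewrite normrM (gtr0_norm (w_gt0 _)) mulrCA ler_pM2l ?w_gt0.
  have wk : 4 / 3 * w k.+1 * `|f| = 1 / 3 * (w k * `|f|).
    by rewrite /w exprS; field.
  rewrite wk in h2.
  set a := \sum_(0 <= _ < _) _ in h1 *; set b := w k * f (x k) in h3 *.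
  set c := \sum_(_ <= _ < n) _ in h2 *.
  have : `|b| <= `|a + (b + c)| + `|a| + `|c|.
    rewrite [in leLHS](_ : b = (a + (b + c)) - a - c); last by ring.
    by rewrite (le_trans (ler_normB _ _))// lerD2r ler_normB.
  have : 0 <= k%:R :> R by [].
  by lra.
have := weakly_cvgn_apply (@atomic_scalar x) (@atomic_bound x) v0.
move=> /cvgP/cvg_seq_bounded [D [_ /(_ (D + 1))]]; rewrite ltrDl => /(_ ltr01) hD.
have := hD (h (Num.bound `|D + 1|)).1 I; apply/negP; rewrite -ltNge.
apply: lt_le_trans (large _); exact: (le_lt_trans (ler_norm _) (archi_boundP (normr_ge0 _))).
Unshelve. all: by end_near. Qed.

End uniform_boundedness.

(** * Compact spaces with a vanishing derived set *)

Section derived_sets.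
Context {R : realType} {M : metricType R}.
Implicit Types E F : set M.

Lemma limit_pointS E F : E `<=` F -> limit_point E `<=` limit_point F.
Proof.
by move=> EF y Ey U /Ey[z [zy Ez Uz]]; exists z; split => //; exact: EF.
Qed.

Lemma closed_limit_point E : closed (limit_point E).
Proof.
move=> y yc U; rewrite nbhsE => -[V [Vo Vy] VU].
have [z [Ez Vz]] := yc V (open_nbhs_nbhs (conj Vo Vy)).
have [zy|zy] := eqVneq z y.
  have [t [tz Et Vt]] := Ez V (open_nbhs_nbhs (conj Vo Vz)).
  by exists t; rewrite -zy; split => //; exact: VU.
(* The ball around [z] excludes [y], so the point found differs from [y]. *)
have [|t [tz Et [Vt ty]]] := Ez (V `&` [set t | mdist z t < mdist z y]).
  apply: filterI; first exact: open_nbhs_nbhs.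
  apply/metricType_numDomainType.nbhs_mdistP.
  by exists (mdist z y) => //=; rewrite mdist_gt0.
exists t; split => //; last exact: VU.
by apply/eqP => ty'; move: ty; rewrite ty' /= ltxx.
Qed.

Lemma closed_derived_set n : closed (derived_set M n).
Proof. by case: n => [|n]; [exact: closedT|exact: closed_limit_point]. Qed.

Lemma derived_setS m n : (m <= n)%N -> derived_set M n `<=` derived_set M m.
Proof.
have S k : derived_set M k.+1 `<=` derived_set M k.
  by elim: k => // k IH; exact: limit_pointS.
move=> /subnK <-; elim: (n - m)%N => // k IH.
by apply: subset_trans IH; rewrite addSn.
Qed.

Hypothesis Mc : compact [set: M].

(** Otherwise the derived sets are closed, nonempty and decreasing, and compactness gives them a
    common point. *)
Lemma derived_set_omega_eq0 : derived_set_omega M = set0 ->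
  exists n, derived_set M n = set0.
Proof.
move=> w0; apply: contrapT => /forallNP nz.
pose G := filter_from [set: nat] (derived_set M).
have GF : ProperFilter G.
  apply: filter_from_proper => [|i _]; last exact/set0P/eqP/nz.
  apply: filter_from_filter => [|i j _ _]; first by exists 0%N.
  exists (maxn i j) => // x xij.
  by split; apply: derived_setS xij; rewrite ?leq_maxl ?leq_maxr.
have [|y [_ yG]] := Mc GF; first by exists 0%N.
suff : derived_set_omega M y by rewrite w0.
move=> n _; apply: closed_derived_set => U Uy.
by apply: yG Uy; exists n.
Qed.

(** A cluster point of the filter of sets containing all but finitely many points of [E] is a limit
    point, since removing it from [E] leaves a member of the filter. *)
Lemma infinite_set_limit_point E : infinite_set E -> limit_point E !=set0.
Proof.
move=> Einf; pose G : set_system M := [set A | finite_set (E `\` A)].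
have GF : ProperFilter G.
  split; first by rewrite /G /= setD0.
  split.
  - by rewrite /G /= setDT.
  - by move=> A B; rewrite /G /= setDIr => ? ?; rewrite finite_setU.
  - by move=> A B AB; rewrite /G /=; apply: sub_finite_set; exact: setDS.
have [|y [_ yG]] := Mc GF; first by rewrite /G /= setDT.
exists y => U Uy.
have [|z [[Ez zy] Uz]] := yG (E `\ y) U _ Uy.
  apply: (@sub_finite_set _ _ [set y]) => // z [Ez /not_andP[//|/contrapT]].
  exact.
by exists z; split => //; exact/eqP.
Qed.

End derived_sets.

(** * Selecting a subsequence with uniformly bounded partial sums *)

Section selection.
Context {R : realType} {M : metricType R}.
Variables (v : nat -> Cb R M) (n : nat) (B : R).
Hypothesis Mc : compact [set: M].
Hypothesis M0 : derived_set M n = set0.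
Hypothesis v0 : forall x, v k x @[k --> \oo] --> 0.
Hypothesis vB : forall k x, `|v k x| <= B.

Let eps k : R := 2^-1 ^+ k.

Let big k t x := eps k <= `|v t x|.

Definition big_count (s : seq nat) x : nat :=
  \sum_(0 <= k < size s) big k (nth 0%N s k) x.

Lemma big_count_rcons s t x :
  big_count (rcons s t) x = (big_count s x + big (size s) t x)%N.
Proof.
rewrite /big_count size_rcons big_nat_recr//= nth_rcons ltnn eqxx; congr addn.
by rewrite big_nat [RHS]big_nat; apply: eq_bigr => k /andP[_ ks]; rewrite nth_rcons ks.
Qed.

(** Closedness, due to the nonstrict inequality in [big], lets big counts pass to limit points. *)
Lemma closed_big_count s i : closed [set x | (i <= big_count s x)%N].
Proof.
elim/last_ind: s i => [|s t IH] [|i].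
- by rewrite (_ : [set _ | _] = setT); [exact: closedT|apply/seteqP].
- rewrite (_ : [set _ | _] = set0); first exact: closed0.
  by apply/seteqP; split => // x; rewrite /big_count/= big_geq.
- by rewrite (_ : [set _ | _] = setT); [exact: closedT|apply/seteqP].
rewrite (_ : [set _ | _] = [set x | (i < big_count s x)%N] `|`
    ([set x | (i <= big_count s x)%N] `&`
      (fun x => `|v t x|) @^-1` [set r : R | eps (size s) <= r])).
  apply: closedU => //; apply: closedI => //.
  apply: closed_comp; last exact: closed_ge.
  by move=> x _; apply: cvg_norm; exact: Cb_continuous.
apply/seteqP; split => x /=; rewrite big_count_rcons /big.
  by case: (_ <= `|_|) => /= h; [right; split => //; lia|left; lia].
by case=> [h|[h ->]]; lia.
Qed.

(** The case [i = n] bounds the count at every point; the case [i = 0] says that the n-th derived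
    set is empty. *)
Definition sparse s :=
  forall i x, derived_set M (n - i) x -> (i <= n)%N -> (big_count s x < i)%N.

(** Only the points of the sets [F i] could violate sparseness after one more big term. An infinite
    [F i] would have a limit point of rank [n - i] with at least [i] big terms, so these sets are
    finite and a late term is small on all of them. Sparseness is a premise inside because
    [history_choice] must extend every list. *)
Lemma sparse_extend s : exists t, (forall u, u \in s -> (u < t)%N) /\
  (sparse s -> sparse (rcons s t)).
Proof.
have [sp|nsp] := pselect (sparse s); last first.
  exists (\max_(u <- s) u).+1; split => // u us.
  by rewrite ltnS; exact: leq_bigmax_seq.
pose F i := [set x | (i <= big_count s x)%N] `&` derived_set M (n - i.+1).
have Ffin i : (i < n)%N -> finite_set (F i).
  move=> ni; apply: contrapT => /(infinite_set_limit_point Mc)[y Fy].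
  have : (big_count s y < i)%N.
    apply: sp (ltnW ni); rewrite -(subnSK ni).
    by apply: limit_pointS Fy; exact: subIsetr.
  rewrite ltnNge => /negP; apply.
  apply: (@closed_big_count s i); apply: subset_limit_point.
  by apply: limit_pointS Fy; exact: subIsetl.
have [r rF] : exists r : seq M, forall i x, (i < n)%N -> F i x -> x \in r.
  have /finite_seqP[r rE] : finite_set (\bigcup_(i in `I_n) F i).
    by apply: bigcup_finite; [exact: finite_II|exact: Ffin].
  exists r => i x ni Fx; suff : [set` r] x by [].
  by rewrite -rE; exists i.
have [t [ts tr]] : exists t, (forall u, u \in s -> (u < t)%N) /\
    forall x, x \in r -> ~~ big (size s) t x.
  have : \forall t \near \oo, (forall u, u \in s -> (u < t)%N) /\
    forall x, x \in r -> ~~ big (size s) t x.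
    apply: filterI.
      exists (\max_(u <- s) u).+1 => // t /= st u us.
      by rewrite (leq_trans _ st)// ltnS; exact: leq_bigmax_seq.
    elim: r {rF} => [|x r IH]; first by near=> t.
    have e0 : 0 < eps (size s) by rewrite exprn_gt0// invr_gt0.
    have /cvgr0Pnorm_lt/(_ _ e0) := v0 x.
    move: IH; apply: filterS2 => t rt xt y; rewrite inE => /predU1P[->|]//.
      by rewrite /big -ltNge.
    exact: rt.
  by case/filter_ex => t; exists t.
exists t; split => // _ i x xi ni; rewrite big_count_rcons.
have ci := sp _ _ xi ni.
have [ci'|ci'] := ltnP (big_count s x).+1 i.
  by rewrite (leq_ltn_trans _ ci')// -addn1 leq_add2l leq_b1.
(* The count is now exactly [i - 1], so [x] lies in [F (i - 1)], where the new term is small. *)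
rewrite (negbTE (tr _ _)) ?addn0//.
case: i => // i in xi ni ci ci' *.
by apply: (rF i).
Unshelve. all: by end_near. Qed.

(** At each point at most [n] terms are big, each at most [B]; the others are below [2^-k] and sum
    to at most 2. *)
Lemma bounded_sum_subsequence : exists2 s : nat -> nat, increasing_seq s &
  forall N x, \sum_(0 <= k < N) `|v (s k) x| <= n%:R * B + 2.
Proof.
have [s sP] := history_choice sparse_extend.
exists s.
  apply/increasing_seqP => k; rewrite ltEnat /=.
  by apply: (sP k.+1).1; rewrite mkseqS mem_rcons mem_head.
have sparse_s N : sparse (mkseq s N).
  elim: N => [|N IH]; last by rewrite mkseqS; exact: (sP N).2.
  move=> [|i] x; first by rewrite subn0 M0.
  by rewrite /big_count/= big_geq.
move=> N x.
have B0 : 0 <= B by exact: le_trans (vB 0%N x).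
have cn : (big_count (mkseq s N) x <= n)%N.
  by apply/ltnW/sparse_s => //; rewrite subnn; exact: I.
rewrite (@le_trans _ _ (\sum_(0 <= k < N) ((big k (s k) x)%:R * B + eps k)))//.
  apply: ler_sum => k _; have := vB (s k) x; rewrite /big.
  have e0 : 0 <= eps k by rewrite exprn_ge0// invr_ge0.
  by have [_|/ltW] := leP (eps k) `|v (s k) x|; rewrite ?mul1r ?mul0r; lra.
rewrite big_split/= -mulr_suml lerD//.
  rewrite ler_wpM2r// -natr_sum ler_nat (leq_trans _ cn)//.
  rewrite /big_count size_mkseq big_nat [leqRHS]big_nat.
  by apply/eq_leq/eq_bigr => k /andP[_ kN]; rewrite nth_mkseq.
suff -> : \sum_(0 <= k < N) eps k = 2 - 2 * eps N.
  have e0 : 0 <= eps N by rewrite exprn_ge0// invr_ge0.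
  by lra.
elim: N {cn} => [|N IH]; first by rewrite big_geq// /eps expr0; lra.
by rewrite big_nat_recr//= IH /eps exprS; lra.
Qed.

End selection.

(** Applied to [u - l], the selection bounds all partial sums by a constant [C], so the means have
    norm at most [C / N]. *)
Lemma compact_weakly_Banach_Saks (R : realType) (M : metricType R) :
  compact [set: M] -> derived_set_omega M = set0 -> weakly_Banach_Saks (Cb R M).
Proof.
move=> Mc /(derived_set_omega_eq0 Mc)[n M0] u l ul.
have v0 : weakly_cvgn (fun k => u k - l) 0.
  move=> phi phic; rewrite linear0 -(subrr (phi l)).
  under eq_cvg do rewrite linearB.
  by apply: cvgB; [exact: ul|exact: cvg_cst].
have [B B0 vB] := weakly_null_bounded v0.
have [s s_incr sB] := bounded_sum_subsequence Mc M0
  (fun x => weakly_cvgn_pointwise (y := x) v0) vB.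
exists s => //; set C := n%:R * B + 2 in sB.
have C0 : 0 < C by rewrite ltr_wpDl// mulr_ge0.
apply/cvgr0Pnorm_le => e e0.
near=> N; rewrite normr_id.
have N0 : (0 < N)%N by near: N; exact: nbhs_infty_gt.
have -> : N%:R^-1 *: \sum_(k < N) u (s k) - l =
    N%:R^-1 *: \sum_(k < N) (u (s k) - l).
  rewrite sumrB sumr_const card_ord scalerBr -(scaler_nat N l) scalerA.
  by rewrite mulVf ?scale1r// pnatr_eq0 -lt0n.
apply: Cb_norm_le => [|x]; first exact: ltW.
rewrite [X in `|X|](_ : _ = N%:R^-1 * \sum_(0 <= k < N) (u (s k) - l) x); last first.
  by rewrite big_mkord -Cb_sumE.
rewrite normrM ger0_norm ?invr_ge0// ler_pdivrMl ?ltr0n//.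
rewrite (le_trans (ler_norm_sum _ _ _))// (le_trans (sB N x))//.
rewrite -ler_pdivrMr//.
near: N; exact: nbhs_infty_ger.
Unshelve. all: by end_near. Qed.

Theorem theorem2p8 (R : realType) (M : metricType R) :
  (compact [set: M] ->
    (weakly_Banach_Saks (Cb R M) <-> derived_set_omega M = set0)) /\
  (~ compact [set: M] -> ~ weakly_Banach_Saks (Cb R M)).
Proof.
split=> [Mc|/schreier_of_noncompact[f]]; last exact: schreier_not_weakly_Banach_Saks.
split=> [wBS|]; last exact: compact_weakly_Banach_Saks.
apply: contrapT => /eqP/set0P/schreier_of_derived_set_omega[f fS].
exact: schreier_not_weakly_Banach_Saks fS wBS.
Qed.
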